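(* Let $d$ be a nonnegative integer and let $H_2(x)=(x+1)^{d+1}-x^{d+1}\in\mathbb{R}[x]$. If $H_2$ is written in the form $$H_2(x)=\sum_{i=1}^l \beta_i (x+y_i)^{e_i}$$ with real constants $\beta_i,y_i$ and nonnegative integers $e_i \leq d$ for every $i$, then $l > (d-1)/2$. *)

(* Defs.v *)
From HB Require Import structures.
From mathcomp Require Import all_boot all_order all_algebra.
From mathcomp Require Import reals.

Set Implicit Arguments.
Unset Strict Implicit.
Unset Printing Implicit Defensive.

Import GRing.Theory.
Local Open Scope ring_scope.

Definition H2 (R : realType) (d : nat) : {poly R} :=
  ('X + 1) ^+ d.+1 - 'X ^+ d.+1.

(* Main.v *)
Require Import Defs.
From HB Require Import structures.
From mathcomp Require Import all_boot all_order all_algebra.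
From mathcomp Require Import polyorder polyrcf zify.
From mathcomp Require Import reals.

(** For [deg P <= d + 1], the apolar pairing of [P] with the identity expresses
    [P.[1] - P.[0]] through the values [P^`(d + 1 - e i).[y i]].  Hence if
    [2 l <= d] it suffices to find such a [P] with [P.[1] = 0 <> P.[0]] whose
    derivatives vanish at these [l] incidences [(y i, d + 1 - e i)].  Cover them
    by at most [l] disjoint pairs [(x, k), (x, k + 1)], that is, by double roots
    of [P^`(k)], and take [P] with [P.[1] = 0] of suitably truncated degree by
    counting dimensions.  That [P.[0] <> 0] follows from a Budan-Fourier count:
    the number of sign changes in [P.[x], P^`().[x], ...] is at most [deg P] on
    the left, nonnegative on the right, and drops by one at each root of [P] and
    by two at each pair. *)

Set Implicit Arguments.
Unset Strict Implicit.
Unset Printing Implicit Defensive.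

Import Order.TTheory GRing.Theory Num.Theory.
Local Open Scope ring_scope.

Lemma uniq_leq_size_count (A : eqType) (s t : seq A) :
  uniq s -> {subset s <= t} -> (size s <= count [in s] t)%N.
Proof.
move=> uniq_s st; rewrite -size_filter uniq_leq_size // => x xs.
by rewrite mem_filter xs st.
Qed.

Lemma sum_count_allpairs (A : Type) (s : seq A) (n : nat)
    (P : pred (A * nat)) :
  (\sum_(c <- s) count [pred k | P (c, k)] (iota 0 n))%N =
  count P [seq (c, k) | c <- s, k <- iota 0 n].
Proof.
rewrite count_flatten sumnE !big_map.
by apply: eq_bigr => c _; rewrite count_map.
Qed.

Lemma addb_triangle (s t u : bool) : (s (+) u <= (s (+) t) + (t (+) u))%N.
Proof. by move: s t u => [] [] []. Qed.

Lemma exists_path_lt (R : numDomainType) (s : seq R) :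
  sorted <%R s -> exists a, path <%R a s.
Proof.
case: s => [|c s] /= c_s; first by exists 0.
by exists (c - 1); rewrite /= c_s gtrBl ltr01.
Qed.

Lemma exists_path_lt_between (R : numFieldType) (c : R) (s : seq R) :
  path <%R c s -> exists2 b, c < b & path <%R b s.
Proof.
case: s => [|d s] /=; first by exists (c + 1); rewrite ?ltrDl.
by case/andP=> /midf_lt[cm md] ds; exists ((c + d) / 2%:R); rewrite ?md.
Qed.

Definition spaced (J : pred nat) := forall k, J k -> ~~ J k.+1.

Fixpoint every_other (P : pred nat) (k : nat) : bool :=
  P k && (if k is j.+1 then ~~ every_other P j else true).

Lemma every_otherW (P : pred nat) (k : nat) : every_other P k -> P k.
Proof. by case: k => [|k] /andP[]. Qed.

Lemma spaced_every_other (P : pred nat) : spaced (every_other P).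
Proof. by move=> k Pk; rewrite /= Pk andbF. Qed.

Lemma every_other_cover (P : pred nat) (k : nat) : P k ->
  every_other P k \/ exists2 j, k = j.+1 & every_other P j.
Proof.
case: k => [|k] /= ->; first by left.
by case: (boolP (every_other P k)) => [|_]; [right; exists k | left].
Qed.

Lemma spaced_succ (J : pred nat) : spaced J -> spaced [pred k | J k.+1].
Proof. by move=> spJ k; apply: spJ. Qed.

Lemma count_iotaS (J : pred nat) (n : nat) :
  count J (iota 0 n.+1) = (J 0 + count [pred k | J k.+1] (iota 0 n))%N.
Proof. by rewrite /= (iotaDl 1 0) count_map. Qed.

Definition level_spaced (A : eqType) (T : seq (A * nat)) :=
  forall x, spaced [pred k | (x, k) \in T].

Lemma level_spaced_filter (A : eqType) (P : pred nat) (T : seq (A * nat)) :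
  level_spaced T -> level_spaced [seq t <- T | P t.2].
Proof.
move=> spT x k /=; rewrite !mem_filter negb_and => /andP[_ /spT/negPf /= ->].
exact: orbT.
Qed.

Lemma level_spaced_cover (A : eqType) (K : seq (A * nat)) :
  exists T : seq (A * nat),
    [/\ uniq T, level_spaced T, {subset T <= K}
      & forall x k, (x, k) \in K ->
          (x, k) \in T \/ exists2 j, k = j.+1 & (x, j) \in T].
Proof.
pose start u := every_other [pred k | (u.1, k) \in K] u.2.
have startE x k : ((x, k) \in [seq u <- undup K | start u]) = start (x, k).
  by rewrite mem_filter mem_undup andb_idr // => /every_otherW.
exists [seq u <- undup K | start u]; split.
- by rewrite filter_uniq ?undup_uniq.
- by move=> x k /=; rewrite !startE; apply: spaced_every_other.
- by move=> u; rewrite mem_filter mem_undup => /andP[].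
by move=> x k /(every_other_cover (P := [pred k | (x, k) \in K]))[|[j ->]] xk;
  [left | right; exists j]; rewrite ?startE.
Qed.

Section DerivnRoot.
Variable R : nzRingType.
Implicit Types (p : {poly R}) (x : R).

Definition derivn_root p (u : R * nat) : bool := root p^`(u.2) u.1.

Definition derivn_double_root p (u : R * nat) : bool :=
  derivn_root p u && derivn_root p (u.1, u.2.+1).

Lemma derivn_double_root_deriv p x (J : pred nat) :
    (forall j, J j -> derivn_double_root p (x, j)) ->
  forall j, J j.+1 -> derivn_double_root p^`() (x, j).
Proof.
by move=> Jp j /Jp; rewrite /derivn_double_root /derivn_root -!derivSn.
Qed.

End DerivnRoot.

Lemma horner_lt0_noroot (R : rcfType) (p : {poly R}) (i : interval R) :
    {in i, forall x, ~~ root p x} ->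
  {in i &, forall x y, (p.[x] < 0) = (p.[y] < 0)}.
Proof.
by move=> noroot x y xi yi; rewrite -sgr_lt0 (polyrN0_itv noroot yi xi) sgr_lt0.
Qed.

Section DerivSign.
Variables (R : rcfType) (p : {poly R}).

Lemma horner_lt0_deriv_right (c b : R) :
    c < b -> root p c -> {in `]c, b], forall x, ~~ root p^`() x} ->
  (p.[b] < 0) = (p^`().[b] < 0).
Proof.
move=> cb /rootP pc noroot; have [z] := poly_mvt p cb.
rewrite in_itv /= pc subr0 => /andP[cz zb] ->; rewrite pmulr_llt0 ?subr_gt0 //.
by apply: (horner_lt0_noroot noroot); rewrite in_itv /= ?cz ?cb ?lexx ?ltW.
Qed.

Lemma horner_lt0_deriv_left (a c : R) :
    a < c -> root p c -> {in `[a, c[, forall x, ~~ root p^`() x} ->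
  (p.[a] < 0) = ~~ (p^`().[a] < 0).
Proof.
move=> ac /rootP pc noroot; have [z] := poly_mvt p ac.
rewrite in_itv /= pc sub0r => /andP[az zc] pa.
have z_in : z \in `[a, c[ by rewrite in_itv /= (ltW az).
rewrite (horner_lt0_noroot noroot (x := a) (y := z)) ?in_itv /= ?lexx //.
rewrite -oppr_gt0 pa pmulr_lgt0 ?subr_gt0 // -leNgt le_eqVlt eq_sym.
by rewrite -rootE (negPf (noroot z z_in)).
Qed.

End DerivSign.

Section Derivatives.
Variable R : realDomainType.
Implicit Types (p : {poly R}) (x : R).

Lemma root_deriv_neq0 p x : p != 0 -> root p x -> p^`() != 0.
Proof.
move=> p0 /(root_size_gt1 p0).
by rewrite -size_poly_gt0 size_deriv ltn_predRL.
Qed.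

Lemma size_derivS p : p != 0 -> size p = (size p^`()).+1.
Proof. by move=> p0; rewrite size_deriv prednK ?size_poly_gt0. Qed.

Definition critical p x : bool := [exists j : 'I_(size p), root p^`(j) x].

Lemma root_critical p x : p != 0 -> root p x -> critical p x.
Proof.
rewrite -size_poly_gt0 => p0 px.
by apply/existsP; exists (Ordinal p0).
Qed.

Lemma critical_deriv p x : critical p^`() x -> critical p x.
Proof.
case/existsP=> -[j /= ltj]; rewrite -derivSn => rj.
have ltSj : (j.+1 < size p)%N by rewrite -ltn_predRL -size_deriv.
by apply/existsP; exists (Ordinal ltSj).
Qed.

(* Zeros are not skipped, so this is the usual number of sign changes only at
   noncritical points; it is compared at such points only. *)
Definition fourier_changes p x : nat :=
  (\sum_(j < size p) (p^`(j).[x] * p^`(j.+1).[x] < 0)%R)%N.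

Lemma fourier_changes_deriv p x : p != 0 ->
  fourier_changes p x = ((p.[x] * p^`().[x] < 0)%R + fourier_changes p^`() x)%N.
Proof.
rewrite -size_poly_gt0 /fourier_changes size_deriv.
case: (size p) => // n _; rewrite big_ord_recl derivn0 derivn1; congr (_ + _)%N.
by apply: eq_bigr => j _; rewrite -!derivSn.
Qed.

Lemma fourier_changes_lt_size p x : p != 0 -> (fourier_changes p x < size p)%N.
Proof.
rewrite -size_poly_gt0 /fourier_changes; case size_p: (size p) => [|n] // _.
have pSn : p^`(n.+1) = 0 by apply/eqP; rewrite -derivn_poly0 size_p.
rewrite big_ord_recr pSn horner0 mulr0 ltxx /= addn0 ltnS.
rewrite -[leqRHS]card_ord -sum1_card.
by apply: leq_sum => j _; apply: leq_b1.
Qed.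

End Derivatives.

Lemma critical_sorted (R : rcfType) (p : {poly R}) :
  exists2 s : seq R, sorted <%R s & forall x, critical p x -> x \in s.
Proof.
pose q := \prod_(j < size p) p^`(j).
have q0 : q != 0.
  by apply/prodf_neq0 => j _; rewrite -derivn_poly0 -ltnNge.
exists (rootsR q); first exact: sorted_roots.
move=> x /existsP[j rj].
rewrite -(roots_on_rootsR q0) in_itv /=.
by rewrite /q (bigD1 j) //= rootM rj.
Qed.

Section FourierChanges.
Variable R : rcfType.
Implicit Types (p : {poly R}) (a b c x : R) (J : pred nat).

Section IsolatedCriticalPoint.
Variables a b c : R.
Hypotheses (ac : a < c) (cb : c < b).

Definition isolated p := {in `[a, b], forall x, critical p x -> x = c}.

Lemma isolated_deriv p : isolated p -> isolated p^`().
Proof. by move=> iso_p x xab /critical_deriv /iso_p ->. Qed.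

Lemma isolated_noroot p x : isolated p -> p != 0 ->
  x \in `[a, b] -> x != c -> ~~ root p x.
Proof.
move=> iso_p p0 xab; apply: contra_neqN => px.
exact/(iso_p x xab)/root_critical.
Qed.

Lemma isolated_noroot_ends p : isolated p -> p != 0 ->
  ~~ root p a /\ ~~ root p b.
Proof.
have ab := ltW (lt_trans ac cb).
by move=> iso_p p0; split; apply: isolated_noroot;
  rewrite // ?in_itv /= ?lexx ?ab ?(lt_eqF ac) ?(gt_eqF cb).
Qed.

Lemma isolated_noroot_sign p : isolated p -> p != 0 -> ~~ root p c ->
  (p.[a] < 0) = (p.[b] < 0).
Proof.
move=> iso_p p0 pc; have ab := ltW (lt_trans ac cb).
apply: (@horner_lt0_noroot _ _ `[a, b]); rewrite ?in_itv /= ?lexx ?ab //.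
move=> x xab.
by have [->//|] := eqVneq x c; apply: isolated_noroot.
Qed.

Lemma isolated_root_sign p : isolated p -> p != 0 -> root p c ->
  (p.[a] < 0) = ~~ (p^`().[a] < 0) /\ (p.[b] < 0) = (p^`().[b] < 0).
Proof.
move=> iso_p p0 pc; have p'0 := root_deriv_neq0 p0 pc.
have noroot := isolated_noroot (isolated_deriv iso_p) p'0.
split; [apply: (horner_lt0_deriv_left ac) | apply: (horner_lt0_deriv_right cb)];
  rewrite // => x; rewrite in_itv /= => /andP[lo hi]; apply: noroot.
- by rewrite in_itv /= lo (ltW (lt_trans hi cb)).
- by rewrite (lt_eqF hi).
- by rewrite in_itv /= hi (ltW (lt_trans ac lo)).
- by rewrite (gt_eqF lo).
Qed.

Lemma fourier_changes_root p : isolated p -> p != 0 -> root p c ->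
  fourier_changes p a = (fourier_changes p^`() a).+1 /\
  fourier_changes p b = fourier_changes p^`() b.
Proof.
move=> iso_p p0 pc; have p'0 := root_deriv_neq0 p0 pc.
have [/negPf pa /negPf pb] := isolated_noroot_ends iso_p p0.
have [/negPf p'a /negPf p'b] := isolated_noroot_ends (isolated_deriv iso_p) p'0.
have [sgn_a sgn_b] := isolated_root_sign iso_p p0 pc.
rewrite !(fourier_changes_deriv _ p0) !mulr_lt0 sgn_a sgn_b -!rootE.
by rewrite pa pb p'a p'b addNb !addbb.
Qed.

(* A sign change between [p] and [p^`()] can only appear where [p^`()] changes
   sign; hence the last term on the left of [fourier_changes_drop]. *)
Lemma fourier_changes_noroot p : isolated p -> p != 0 -> ~~ root p c ->
  (fourier_changes p b + fourier_changes p^`() a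
     <= fourier_changes p a + fourier_changes p^`() b
        + (p^`().[a] * p^`().[b] < 0)%R)%N.
Proof.
move=> iso_p p0 pc; have sgn_ab := isolated_noroot_sign iso_p p0 pc.
rewrite !(fourier_changes_deriv _ p0).
have [->|p'0] := eqVneq p^`() 0; first by rewrite !horner0 !mulr0 ltxx; lia.
have [/negPf pa /negPf pb] := isolated_noroot_ends iso_p p0.
have [/negPf p'a /negPf p'b] := isolated_noroot_ends (isolated_deriv iso_p) p'0.
rewrite !mulr_lt0 sgn_ab -!rootE pa pb p'a p'b /=.
by rewrite [leqRHS](ACl (1*4*3*2)) !leq_add2r addb_triangle.
Qed.

Lemma fourier_changes_double_root p :
    isolated p -> p != 0 -> root p c -> root p^`() c ->
  [/\ fourier_changes p a = (fourier_changes p^`()^`() a).+2,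
      fourier_changes p b = fourier_changes p^`()^`() b
    & (p.[a] * p.[b] < 0) = (p^`()^`().[a] * p^`()^`().[b] < 0)].
Proof.
move=> iso_p p0 pc p'c; have p'0 := root_deriv_neq0 p0 pc.
have iso_p' := isolated_deriv iso_p; have iso_p'' := isolated_deriv iso_p'.
have [-> ->] := fourier_changes_root iso_p p0 pc.
have [-> ->] := fourier_changes_root iso_p' p'0 p'c.
split=> //.
have [sgn_a sgn_b] := isolated_root_sign iso_p p0 pc.
have [sgn'_a sgn'_b] := isolated_root_sign iso_p' p'0 p'c.
have [/negPf pa /negPf pb] := isolated_noroot_ends iso_p p0.
have [/negPf p''a /negPf p''b] :=
  isolated_noroot_ends iso_p'' (root_deriv_neq0 p'0 p'c).
rewrite !mulr_lt0 -!rootE pa pb p''a p''b.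
by rewrite sgn_a sgn_b sgn'_a sgn'_b negbK.
Qed.

Lemma fourier_changes_drop p J :
    isolated p -> spaced J -> (forall j, J j -> derivn_double_root p (c, j)) ->
  (fourier_changes p b + 2 * count J (iota 0 (size p)) + (p.[a] * p.[b] < 0)%R
     <= fourier_changes p a)%N.
Proof.
have [n] := ubnP (size p); elim: n p J => // n IHn p J lt_pn iso_p spJ Jp.
have [->|p0] := eqVneq p 0.
  by rewrite /fourier_changes size_poly0 !big_ord0 horner0 mul0r ltxx.
have size_p : size p = (size p^`()).+1 := size_derivS p0.
have lt_p'n : (size p^`() < n)%N by rewrite -ltnS -size_p.
have Jp' := derivn_double_root_deriv Jp.
have IHp' := IHn p^`() _ lt_p'n (isolated_deriv iso_p) (spaced_succ spJ) Jp'.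
rewrite size_p count_iotaS.
have [pc|pc] := boolP (root p c); last first.
  have -> : J 0%N = false by apply: contraNF pc => /Jp /andP[].
  have -> : (p.[a] * p.[b] < 0) = false.
    by rewrite mulr_lt0 (isolated_noroot_sign iso_p p0 pc) addbb !andbF.
  by have := fourier_changes_noroot iso_p p0 pc; lia.
have [J0|_] := boolP (J 0%N); last first.
  by have [-> ->] := fourier_changes_root iso_p p0 pc; lia.
have /andP[_ p'c] := Jp _ J0.
have size_p' : size p^`() = (size p^`()^`()).+1.
  exact: size_derivS (root_deriv_neq0 p0 pc).
have [-> -> ->] := fourier_changes_double_root iso_p p0 pc p'c.
have Jp'' := derivn_double_root_deriv (J := [pred k | J k.+1]) Jp'.
have iso_p'' := isolated_deriv (isolated_deriv iso_p).
have lt_p''n : (size p^`()^`() < n)%N by rewrite ltnW // -size_p'.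
have := IHn p^`()^`() _ lt_p''n iso_p'' (spaced_succ (spaced_succ spJ)) Jp''.
by rewrite size_p' count_iotaS /= (negPf (spJ _ J0)); lia.
Qed.

Lemma fourier_changes_drop_roots p J (z : bool) :
    p != 0 -> isolated p -> spaced J ->
    (forall j, J j -> derivn_double_root p (c, j)) ->
    (z -> root p c) -> (z -> ~~ J 0%N) ->
  (fourier_changes p b + (z + 2 * count J (iota 0 (size p)))
     <= fourier_changes p a)%N.
Proof.
move=> p0 iso_p spJ Jp.
case: z => [/(_ isT) pc /(_ isT)/negPf J0|_ _]; last first.
  apply: leq_trans (fourier_changes_drop iso_p spJ Jp).
  by rewrite add0n leq_addr.
have := fourier_changes_drop (isolated_deriv iso_p) (spaced_succ spJ)
  (derivn_double_root_deriv Jp).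
have [-> ->] := fourier_changes_root iso_p p0 pc.
have size_p : size p = (size p^`()).+1 := size_derivS p0.
by rewrite size_p count_iotaS J0; lia.
Qed.

End IsolatedCriticalPoint.

Lemma fourier_changes_ge_sum p (w : R -> nat) a (s : seq R) :
    (forall u c v, u < c -> c < v -> isolated u v c p ->
       (fourier_changes p v + w c <= fourier_changes p u)%N) ->
    path <%R a s -> (forall x, a <= x -> critical p x -> x \in s) ->
  (\sum_(c <- s) w c <= fourier_changes p a)%N.
Proof.
move=> drop; elim: s a => [|c s IHs] a; first by rewrite big_nil.
case/andP=> ac /exists_path_lt_between[b cb b_s] crit_s; rewrite big_cons addnC.
have b_lt x : x \in s -> b < x by move/(allP (order_path_min lt_trans b_s)).
apply: leq_trans (drop a c b ac cb _); last first.
  move=> x /[!in_itv] /= /andP[ax xb] /(crit_s x ax).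
  by rewrite inE => /predU1P[//|/b_lt]; rewrite ltNge xb.
rewrite leq_add2r; apply: IHs b_s _ => x bx crit_x.
have cx := lt_le_trans cb bx.
by have := crit_s x (ltW (lt_trans ac cx)) crit_x; rewrite inE (gt_eqF cx).
Qed.

(* The zero count of the Atkinson-Sharma theorem on Birkhoff interpolation. *)
Lemma max_poly_roots_derivn_double_roots p (Z : seq R) (T : seq (R * nat)) :
    p != 0 -> uniq Z -> all (root p) Z -> uniq T -> level_spaced T ->
    all (derivn_double_root p) T -> {in T, forall u, (u.2 < size p)%N} ->
    {in Z, forall x, (x, 0%N) \notin T} ->
  (size Z + 2 * size T < size p)%N.
Proof.
move=> p0 uniq_Z /allP root_Z uniq_T spT /allP double_T T_lt ZT.
have [s sorted_s crit_s] := critical_sorted p.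
have Z_s : {subset Z <= s} by move=> x /root_Z/(root_critical p0)/crit_s.
have T_s : {subset T <= [seq (x, k) | x <- s, k <- iota 0 (size p)]}.
  move=> [x k] xkT; have lt_k := T_lt _ xkT.
  rewrite allpairs_f ?mem_iota //; apply/crit_s/existsP.
  by exists (Ordinal lt_k); have /andP[] := double_T _ xkT.
pose w c := ((c \in Z) + 2 * count [pred k | (c, k) \in T] (iota 0 (size p)))%N.
have drop a c b : a < c -> c < b -> isolated a b c p ->
    (fourier_changes p b + w c <= fourier_changes p a)%N.
  move=> ac cb iso_p.
  by apply: (fourier_changes_drop_roots ac cb) => // [k|cZ|cZ];
    [exact: double_T | exact: root_Z | exact: ZT].
have [a a_s] := exists_path_lt sorted_s.
apply: leq_ltn_trans (fourier_changes_lt_size a p0).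
apply: leq_trans (fourier_changes_ge_sum drop a_s (fun x _ => @crit_s x)).
rewrite /w big_split -big_distrr /= sum_count_allpairs.
have <- : count [in Z] s = (\sum_(c <- s) (c \in Z))%N.
  by rewrite -sumn_count sumnE big_map.
by rewrite leq_add ?leq_mul2l ?uniq_leq_size_count.
Qed.

End FourierChanges.

Lemma exists_poly_derivn_roots (F : fieldType) (n : nat) (us : seq (F * nat)) :
    (size us < n)%N ->
  exists p : {poly F}, [/\ p != 0, (size p <= n)%N & all (derivn_root p) us].
Proof.
move=> lt_us; pose u j := nth (0, 0%N) us j.
pose M := \matrix_(i < n, j < size us) ('X^i)^`((u j).2).[(u j).1].
have : kermx M != 0.
  rewrite -mxrank_eq0 mxrank_ker subn_eq0 -ltnNge.
  exact: leq_ltn_trans (rank_leq_col M) lt_us.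
case/rowV0Pn=> v /sub_kermxP vM v0; exists (rVpoly v); split.
- by apply: contraNneq v0 => pv0; rewrite -[v]rVpolyK pv0 linear0.
- exact: size_poly.
apply/(all_nthP (0, 0%N)) => j lt_j; rewrite -/(u j) /derivn_root /root.
have := congr1 (fun N : 'rV_(size us) => N 0 (Ordinal lt_j)) vM.
rewrite !mxE => <-; apply/eqP.
rewrite [v in rVpoly v]row_sum_delta !linear_sum /= horner_sum.
by apply: eq_bigr => i _; rewrite !linearZ /= rVpoly_delta hornerZ mxE.
Qed.

(* Truncating at the least [m] for which the conditions below level [m] leave a
   polynomial free enforces the Polya condition below the degree of [p]. *)
Lemma exists_poly_double_roots_separating (R : rcfType) (a b : R)
    (T : seq (R * nat)) (n : nat) :
    a != b -> uniq T -> level_spaced T ->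
    (a, 0%N) \notin T -> (b, 0%N) \notin T -> (2 * size T + 1 < n)%N ->
  exists p : {poly R},
    [/\ (size p <= n)%N, all (derivn_double_root p) T, root p a & ~~ root p b].
Proof.
move=> ab uniq_T spT aT bT lt_Tn.
pose below m := [seq u <- T | (u.2 < m)%N].
have le_below m : (size (below m) <= size T)%N.
  by rewrite size_filter count_size.
have ex_m : exists m, (2 * size (below m) + 1 < m)%N.
  by exists n; have := le_below n; lia.
case: (ex_minnP ex_m) => m lt_m min_m.
have le_mn : (m <= n)%N by apply: min_m; have := le_below n; lia.
have [|p [p0 le_pm]] := @exists_poly_derivn_roots R m
    ((a, 0%N) :: below m ++ [seq (u.1, u.2.+1) | u <- below m]).
  by rewrite /= size_cat size_map; lia.
rewrite /= all_cat all_map -all_predI => /andP[pa /allP double_below].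
have double_T : all (derivn_double_root p) T.
  apply/allP=> u uT; have [lt_um|le_mu] := ltnP u.2 m.
    by apply: double_below; rewrite mem_filter lt_um.
  have p_mu k : (m <= k)%N -> p^`(k) = 0.
    by move=> le_mk; apply/eqP; rewrite -derivn_poly0 (leq_trans le_pm).
  by rewrite /derivn_double_root /derivn_root !p_mu ?root0 // leqW.
exists p; split=> //; first exact: leq_trans le_pm le_mn.
apply/negP=> pb.
have : (2 + 2 * size (below (size p)) < size p)%N.
  apply: (max_poly_roots_derivn_double_roots (Z := [:: a; b])) => //=.
  - by rewrite inE ab.
  - by rewrite pb !andbT.
  - exact: filter_uniq.
  - exact: (@level_spaced_filter _ (ltn^~ (size p))).
  - by rewrite all_filter (sub_all _ double_T) // => u /= ->; rewrite implybT.
  - by move=> u; rewrite mem_filter => /andP[].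
  by move=> x /[!inE]/orP[]/eqP->; rewrite mem_filter negb_and ?aT ?bT orbT.
have : (size (below (size p).-1) <= size (below (size p)))%N.
  by rewrite !size_filter; apply: sub_count => u /=; lia.
by have := min_m (size p).-1; lia.
Qed.

Lemma coef_XaddC_exp (R : comNzRingType) (a : R) (e i : nat) :
  (('X + a%:P) ^+ e)`_i = a ^+ (e - i) *+ 'C(e, i).
Proof.
have -> : ('X + a%:P) ^+ e = \poly_(j < e.+1) (a ^+ (e - j) *+ 'C(e, j)).
  rewrite addrC exprDn poly_def; apply: eq_bigr => j _.
  by rewrite -rmorphXn mul_polyC scalerMnl.
by rewrite coef_poly ltnS; case: leqP => // lt_ei; rewrite bin_small.
Qed.

Lemma size_derivn_leq (R : nzSemiRingType) (p : {poly R}) (m : nat) :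
  (size p^`(m) <= size p - m)%N.
Proof.
apply/leq_sizeP=> i le_i; rewrite coef_derivn nth_default ?mul0rn //.
by rewrite -leq_subLR.
Qed.

Lemma fact_bin_ffact (n e i : nat) : (i <= e)%N -> (e <= n)%N ->
  ((n - i)`! * i`! * 'C(e, i) = e`! * (n - i) ^_ (n - e))%N.
Proof.
move=> le_ie le_en; rewrite -(bin_fact le_ie) -(@ffact_fact (n - i) (n - e)).
  have -> : (n - i - (n - e) = e - i)%N by lia.
  by lia.
exact: leq_sub2l.
Qed.

Section Apolar.
Variables (R : comNzRingType) (n : nat).
Implicit Types p q : {poly R}.

(* The factors [(n - i)`! * i`!] are chosen so that the pairing with a power of
   ['X + a] is the evaluation of a derivative at [a]. *)
Definition apolar p q : R :=
  \sum_(i < n.+1) p`_(n - i) * ((n - i)`! * i`!)%:R * q`_i.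

Fact apolar_is_linear p : scalar (apolar p).
Proof.
move=> k q r; rewrite /apolar mulr_sumr -big_split; apply: eq_bigr => i _ /=.
by rewrite coefD coefZ mulrDr mulrCA.
Qed.

HB.instance Definition _ p :=
  GRing.isLinear.Build R {poly R} R _ (apolar p) (apolar_is_linear p).

Lemma apolar_XaddC_exp p (a : R) (e : nat) : (e <= n)%N -> (size p <= n.+1)%N ->
  apolar p (('X + a%:P) ^+ e) = e`!%:R * p^`(n - e).[a].
Proof.
move=> le_en le_pn.
have size_p : (size p^`(n - e) <= e.+1)%N.
  by rewrite (leq_trans (size_derivn_leq _ _)) // leq_subLR addnS subnK.
rewrite (horner_coef_wide _ size_p) mulr_sumr (reindex_inj rev_ord_inj) /apolar.
rewrite (big_ord_widen n.+1 (fun i => e`!%:R *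
  ((p^`(n - e))`_(e.+1 - i.+1) * a ^+ (e.+1 - i.+1)))) // [RHS]big_mkcond.
apply: eq_bigr => i _ /=; rewrite coef_XaddC_exp ltnS subSS.
have [le_ie|lt_ei] := leqP i e; last by rewrite bin_small // mulr0n mulr0.
rewrite coef_derivn; have -> : (n - e + (e - i) = n - i)%N by lia.
rewrite -[_ ^+ _ *+ _]mulr_natr -[p`__ *+ _]mulr_natr mulrACA -natrM.
by rewrite fact_bin_ffact // natrM [in RHS]mulrAC mulrCA.
Qed.

End Apolar.

Lemma horner_eq_XaddC_exp_sum (R : numDomainType) (n l : nat) (a b : R)
    (beta y : 'I_l -> R) (e : 'I_l -> nat) (p : {poly R}) :
    ('X + b%:P) ^+ n - ('X + a%:P) ^+ n
      = \sum_(i < l) beta i *: ('X + (y i)%:P) ^+ e i ->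
    (forall i, e i <= n)%N -> (size p <= n.+1)%N ->
    (forall i, root p^`(n - e i) (y i)) ->
  p.[b] = p.[a].
Proof.
move=> /(congr1 (apolar n p)) + le_en size_p van; rewrite linearB linear_sum /=.
rewrite !apolar_XaddC_exp // subnn derivn0 big1 => [|i _]; last first.
  by rewrite linearZ /= apolar_XaddC_exp // (rootP (van i)) !mulr0.
move/eqP; rewrite -mulrBr mulf_eq0 pnatr_eq0 eqn0Ngt fact_gt0 /= subr_eq0.
by move/eqP.
Qed.

Theorem theorem15 (R : realType) (d l : nat)
    (beta y : 'I_l -> R) (e : 'I_l -> nat)
    (he : forall i : 'I_l, (e i <= d)%N)
    (hH : H2 R d = \sum_(i < l) beta i *: ('X + (y i)%:P) ^+ e i) :
  (d%:R - 1) / 2%:R < l%:R :> R.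
Proof.
suff lt_d2l : (d < 2 * l)%N.
  by rewrite ltr_pdivrMr ?ltr0n // ltrBlDr -natrM natr1 ltr_nat; lia.
rewrite ltnNge; apply/negP=> le_2ld.
pose K := [seq (y i, (d.+1 - e i)%N) | i : 'I_l].
have [T [uniq_T spT TK cover_K]] := level_spaced_cover K.
have lt_Td : (2 * size T + 1 < d.+2)%N.
  rewrite addn1 !ltnS (leq_trans _ le_2ld) // leq_mul2l.
  by rewrite (leq_trans (uniq_leq_size uniq_T TK)) // size_map size_enum_ord.
have T_gt0 x : (x, 0%N) \notin T.
  by apply/negP=> /TK /mapP[i _ [_]]; have := he i; lia.
have [p [size_p /allP double_T p1 /negP[]]] :=
  exists_poly_double_roots_separating (oner_neq0 R) uniq_T spT
    (T_gt0 1) (T_gt0 0) lt_Td.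
have van i : root p^`(d.+1 - e i) (y i).
  have : (y i, (d.+1 - e i)%N) \in K by rewrite map_f ?mem_enum.
  by case/cover_K=> [/double_T/andP[]|[k -> /double_T/andP[]]].
have H2E : ('X + 1%:P) ^+ d.+1 - ('X + 0%:P) ^+ d.+1 = H2 R d by rewrite addr0.
have le_e i : (e i <= d.+1)%N by rewrite leqW.
by rewrite /root -(horner_eq_XaddC_exp_sum (etrans H2E hH) le_e size_p van).
Qed.
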